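(* (Uniqueness Theorem) Let $(V,\boldsymbol1,T,Y,\hat{\mathcal S})$ be an $\hat{\mathcal S}$-logarithmic vertex algebra. If $\mathcal U\subset\mathrm{LF}_T(V)$ is an $\hat{\mathcal S}$-local space of translation covariant logarithmic fields containing $Y_z(V)$, then $\mathcal U=Y_z(V)$. In particular, for any $a(z)\in\mathcal U$, we have $a(z)=Y(v,z)$ where $v=a(z)\boldsymbol1|_{z=0}$.
   Context: Conventions. All superspaces, tensor products and Hom's are over $\mathbb C$; $p(v)$ is the parity; formulas with $p$ are for homogeneous elements, extended linearly. $(\phi\otimes\psi)(a\otimes b)=(-1)^{p(\psi)p(a)}\phi(a)\otimes\psi(b)$; $[\cdot,\cdot]$ is the supercommutator, $\mathrm{ad}(a)b=[a,b]$; $P(a\otimes b)=(-1)^{p(a)p(b)}b\otimes a$; $I$ is the identity operator. $z,z_1,z_2,\dots$ and $\zeta,\zeta_1,\zeta_2,\dots$ are commuting even formal variables ($\zeta_i$ plays the role of $\log z_i$; setting $z_1=z$ also sets $\zeta_1=\zeta$). $D_z=\partial_z+z^{-1}\partial_\zeta$, $z_{12}=z_1-z_2$, $x^{(k)}=x^k/k!$ for $k\ge0$ and $x^{(k)}=0$ for $k<0$. $\vartheta_{12}=\zeta_1-\sum_{n\ge1}\frac1n z_1^{-n}z_2^n$, $\vartheta_{21}=\zeta_2-\sum_{n\ge1}\frac1n z_1^{n}z_2^{-n}$. Logarithmic fields. $\mathrm{LF}(V)=\mathrm{Hom}(V,V(\!(z)\!)[\zeta])$, with its natural superspace structure; elements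 are written $a(z)=a(z,\zeta)$. A field is translation covariant if $[T,a(z)]=D_za(z)$; $\mathrm{LF}_T(V)$ is the space of such fields; for $a\in \mathrm{LF}_T(V)$ one has $a(z)\boldsymbol1\in V[\![z]\!]$. Braiding map. A braiding map on a superspace $U$ is an even element $\mathcal S\in\mathrm{End}(U)\otimes\mathrm{End}(U)$ with $\mathcal SP=P\mathcal S$ and $[\mathcal S_{12},\mathcal S_{23}]=[\mathcal S_{13},\mathcal S_{23}]=[\mathcal S_{12},\mathcal S_{13}]=0$ on $U^{\otimes3}$, where $\mathcal S_{12}=\mathcal S\otimes I$, $\mathcal S_{23}=I\otimes\mathcal S$, $\mathcal S_{13}=(I\otimes P)\mathcal S_{12}(I\otimes P)$. Throughout, $\hat{\mathcal S}$ is assumed to be a braiding map defined on all of $\mathrm{LF}(V)$, $\hat{\mathcal S}=\sum_{i}\Phi_i\otimes\Psi_i$ (finite sum) with the $\Phi_i$ linearly independent, the $\Psi_i$ linearly independent, $p(\Phi_i)=p(\Psi_i)$; it acts on $a(z_1)\otimes b(z_2)$ by $\sum_i(-1)^{p(\Psi_i)p(a)}(\Phi_ia)(z_1)\otimes(\Psi_ib)(z_2)$. Locality. Let $\mu(a(z_1)\otimes b(z_2))=a(z_1)b(z_2)$. A subspace $\mathcal V\subset\mathrm{LF}(V)$ is $\hat{\mathcal S}$-local if: (i) $\Phi_i\mathcal V\subset\mathcal V$ and $\Psi_i\mathcal V\subset\mathcal V$ for all $i$; (ii) for all $a,b\in\mathcal V$ there is $r\ge1$ with $\hat{\mathcal S}^r(a\otimes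 b)=0$; (iii) for all $a,b\in\mathcal V$ there is an integer $N\ge0$ with $\mu(z_{12}^Ne^{\vartheta_{12}\hat{\mathcal S}}a(z_1)\otimes b(z_2))=(-1)^{p(a)p(b)}\mu(z_{12}^Ne^{\vartheta_{21}\hat{\mathcal S}}b(z_2)\otimes a(z_1))$. Products. For $a,b$ in an $\hat{\mathcal S}$-local $\mathcal V$ and $n\in\mathbb Z$, $a_{(n+\hat{\mathcal S})}b=\hat\mu_{(n)}(a\otimes b)\in\mathrm{LF}(V)$ is $$\bigl(a(z)_{(n+\hat{\mathcal S})}b(z)\bigr)v=D_{z_1}^{(N-1-n)}\mu\bigl(z_{12}^Ne^{\vartheta_{12}\hat{\mathcal S}}a(z_1)\otimes b(z_2)\bigr)v\Big|_{z_1=z_2=z,\ \zeta_1=\zeta_2=\zeta}$$ with $N$ as in (iii) (independent of $N$). $\hat{\mathcal S}$-logarithmic vertex algebra $(V,\boldsymbol1,T,Y,\hat{\mathcal S})$: a superspace $V$, an even vector $\boldsymbol1$, an even $T\in\mathrm{End}(V)$, an even linear map $Y_z:V\to\mathrm{LF}(V)$, $a\mapsto Y(a,z)$, and a braiding map $\hat{\mathcal S}$ on $Y_z(V)$ such that: (vacuum) $Y(\boldsymbol1,z)=I$, $Y(a,z)\boldsymbol1\in V[\![z]\!]$, $Y(a,z)\boldsymbol1|_{z=0}=a$, $T\boldsymbol1=0$; (covariance) $[\mathrm{ad}(T)\otimes I,\hat{\mathcal S}]=[D_z\otimes I,\hat{\mathcal S}]=0$, $[T,Y(a,z)]=D_zY(a,z)$;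 (locality) $Y_z(V)$ is $\hat{\mathcal S}$-local; (hexagon) for all $n\in\mathbb Z$, $\hat{\mathcal S}(\hat\mu_{(n)}\otimes I)=(\hat\mu_{(n)}\otimes I)(\hat{\mathcal S}_{13}+\hat{\mathcal S}_{23})$ on $Y_z(V)^{\otimes3}$. *)

(* Defs.v *)
From HB Require Import structures.
From mathcomp Require Import all_boot all_order all_algebra.
From mathcomp Require Import boolp classical_sets functions cardinality fsbigop.
From mathcomp Require Import generic_quotient reals complex.

Set Implicit Arguments.
Unset Strict Implicit.
Unset Printing Implicit Defensive.

Import Order.TTheory GRing.Theory Num.Theory.
Local Open Scope classical_set_scope.
Local Open Scope quotient_scope.
Local Open Scope ring_scope.

(* The decomposition V = V_0 (+) V_1 is given by its two projections
   [parity_part p], p = false for even and p = true for odd. *)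
HB.mixin Record Lmodule_isSuperspace (K : nzRingType) V
    of GRing.Lmodule K V := {
  parity_part : bool -> V -> V;
  parity_part_linear : forall p c u v,
    parity_part p (c *: u + v) = c *: parity_part p u + parity_part p v;
  parity_partK : forall p q v,
    parity_part p (parity_part q v) = if p == q then parity_part q v else 0;
  parity_partD : forall v, parity_part false v + parity_part true v = v
}.

#[short(type="superType")]
HB.structure Definition Superspace (K : nzRingType) :=
  { V of GRing.Lmodule K V & Lmodule_isSuperspace K V }.

HB.instance Definition _ (K : nzRingType) (V : superType K) (p : bool) :=
  GRing.isLinear.Build K V V _ (@parity_part K V p) (parity_part_linear p).

Section Super.
Variable K : nzRingType.
Implicit Types U V W : superType K.

Definition homogeneous V (p : bool) (v : V) : Prop := parity_part p v = v.

Definition has_parity U W (p : bool) (f : U -> W) : Prop :=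
  forall q u, homogeneous q u -> homogeneous (p (+) q) (f u).

(* v |-> (-1)^(p * p(v)) v *)
Definition koszul V (p : bool) (v : V) : V :=
  parity_part false v + (-1) ^+ p *: parity_part true v.

Definition subspace V (A : set V) : Prop :=
  [/\ A 0, forall c u v, A u -> A v -> A (c *: u + v)
    & forall p v, A v -> A (parity_part p v)].

End Super.

(* Two formal sums of pairs are identified when every bilinear map into a
   vector space takes the same value on them, so that the quotient is U (x) W
   by its universal property ([tlift_pure] and [tlift_linear] below). *)
Section Tensor.
Variables (K : fieldType) (U W : lmodType K).

Definition bilin (X : lmodType K) (g : U -> W -> X) : Prop :=
  (forall c u u' w, g (c *: u + u') w = c *: g u w + g u' w) /\
  (forall c u w w', g u (c *: w + w') = c *: g u w + g u w').

Definition fsum (X : nmodType) (g : U -> W -> X) (s : seq (U * W)) : X :=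
  \sum_(x <- s) g x.1 x.2.

Definition tens_eq (s t : seq (U * W)) : bool :=
  `[< forall (X : lmodType K) (g : U -> W -> X),
        bilin g -> fsum g s = fsum g t >].

Lemma tens_eq_refl : reflexive tens_eq.
Proof. by move=> s; apply/asboolP. Qed.

Lemma tens_eq_sym : symmetric tens_eq.
Proof.
by move=> s t; apply/asboolP/asboolP => h X g hg; rewrite h.
Qed.

Lemma tens_eq_trans : transitive tens_eq.
Proof.
move=> t s r /asboolP h1 /asboolP h2; apply/asboolP => X g hg.
by rewrite h1 // h2.
Qed.

Canonical tens_equiv :=
  EquivRel tens_eq tens_eq_refl tens_eq_sym tens_eq_trans.

Definition tens := {eq_quot tens_equiv}.

HB.instance Definition _ := Choice.on tens.

Definition tpure (u : U) (w : W) : tens := \pi_tens [:: (u, w)].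

Definition tlift (X : nmodType) (g : U -> W -> X) (t : tens) : X :=
  fsum g (repr t).

Let tadd (s t : tens) : tens := \pi_tens (repr s ++ repr t).
Let tscale (c : K) (t : tens) : tens :=
  \pi_tens [seq (c *: x.1, x.2) | x <- repr t].
Let tzero : tens := \pi_tens [::].
Let topp (t : tens) : tens := tscale (-1) t.

Lemma tens_eqP s t :
  (forall (X : lmodType K) (g : U -> W -> X), bilin g ->
     fsum g s = fsum g t) -> \pi_tens s = \pi_tens t.
Proof. by move=> h; apply/eqmodP/asboolP. Qed.

Lemma tlift_pi (X : lmodType K) (g : U -> W -> X) s : bilin g ->
  tlift g (\pi_tens s) = fsum g s.
Proof.
move=> hg; rewrite /tlift; have : \pi_tens (repr (\pi_tens s)) = \pi_tens s.
  by rewrite reprK.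
by move/eqmodP/asboolP; apply.
Qed.

Lemma tens_ext (s t : tens) :
  (forall (X : lmodType K) (g : U -> W -> X), bilin g ->
     tlift g s = tlift g t) -> s = t.
Proof.
move=> h; rewrite -[s]reprK -[t]reprK; apply: tens_eqP => X g hg.
exact: h.
Qed.

Let tliftD X (g : U -> W -> (X : lmodType K)) s t : bilin g ->
  tlift g (tadd s t) = tlift g s + tlift g t.
Proof. by move=> hg; rewrite tlift_pi // /fsum big_cat. Qed.

Let tliftZ X (g : U -> W -> (X : lmodType K)) c t : bilin g ->
  tlift g (tscale c t) = c *: tlift g t.
Proof.
move=> hg; rewrite tlift_pi // /fsum big_map /= scaler_sumr.
apply: eq_bigr => x _; have [h1 _] := hg.
have g0 w : g 0 w = 0.
  by have := h1 (-1) 0 0 w; rewrite scaler0 addr0 scaleN1r addNr.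
by have := h1 c x.1 0 x.2; rewrite !addr0 g0 addr0.
Qed.

Let tlift0 X (g : U -> W -> (X : lmodType K)) : bilin g -> tlift g tzero = 0.
Proof. by move=> hg; rewrite tlift_pi // /fsum big_nil. Qed.

Let tensE := (tliftD, tliftZ, tlift0).

Let taddA : associative tadd.
Proof. by move=> s t r; apply: tens_ext => X g hg; rewrite !tensE // addrA. Qed.
Let taddC : commutative tadd.
Proof. by move=> s t; apply: tens_ext => X g hg; rewrite !tensE // addrC. Qed.
Let tadd0 : left_id tzero tadd.
Proof. by move=> s; apply: tens_ext => X g hg; rewrite !tensE // add0r. Qed.
Let taddN : left_inverse tzero topp tadd.
Proof.
by move=> s; apply: tens_ext => X g hg; rewrite !tensE // scaleN1r addNr.
Qed.

HB.instance Definition _ := GRing.isZmodule.Build tens taddA taddC tadd0 taddN.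

Let tscaleA a b v : tscale a (tscale b v) = tscale (a * b) v.
Proof. by apply: tens_ext => X g hg; rewrite !tensE // scalerA. Qed.
Let tscale1 : left_id 1 tscale.
Proof. by move=> s; apply: tens_ext => X g hg; rewrite !tensE // scale1r. Qed.
Let tscaleDr : right_distributive tscale +%R.
Proof.
by move=> a s t; apply: tens_ext => X g hg; rewrite !tensE // scalerDr.
Qed.
Let tscaleDl v : {morph tscale^~ v : a b / a + b}.
Proof.
by move=> a b; apply: tens_ext => X g hg; rewrite !tensE // scalerDl.
Qed.

HB.instance Definition _ :=
  GRing.Zmodule_isLmodule.Build K tens tscaleA tscale1 tscaleDr tscaleDl.

Lemma tlift_linear (X : lmodType K) (g : U -> W -> X) : bilin g ->
  forall c s t, tlift g (c *: s + t) = c *: tlift g s + tlift g t.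
Proof. by move=> hg c s t; rewrite tliftD // tliftZ. Qed.

Lemma tlift_pure (X : lmodType K) (g : U -> W -> X) u w : bilin g ->
  tlift g (tpure u w) = g u w.
Proof. by move=> hg; rewrite tlift_pi // /fsum big_seq1. Qed.

Lemma tpure_bilin : bilin tpure.
Proof.
split=> [c u u' w|c u w w']; apply: tens_ext => X g hg;
  by rewrite tlift_linear // !tlift_pure //; case: hg.
Qed.

(* image of A (x) B in U (x) W, for subspaces A and B *)
Definition tspan (A : set U) (B : set W) : set tens :=
  [set t | exists2 s : seq (U * W),
     (forall x, x \in s -> A x.1 /\ B x.2) & t = fsum tpure s].

(* Linear extension of a map that is bilinear on A x B only: the value at t is
   computed from any expression of t as a sum of a (x) b, a in A, b in B. *)
Definition tlift_on (A : set U) (B : set W) (X : nmodType)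
    (g : U -> W -> X) (t : tens) : X :=
  fsum g (xget [::] [set s : seq (U * W) |
    (forall x, x \in s -> A x.1 /\ B x.2) /\ t = fsum tpure s]).

End Tensor.

Section TensorMaps.
Variable K : fieldType.

(* f (x) g for g even: there is no sign *)
Definition tmap (U U' W W' : lmodType K) (f : U -> U') (g : W -> W')
    : tens U W -> tens U' W' :=
  tlift (fun u w => tpure (f u) (g w)).

Definition tassoc (U V W : lmodType K) (t : tens (tens U V) W)
    : tens U (tens V W) :=
  tlift (fun x w => tlift (fun u v => tpure u (tpure v w)) x) t.

Definition tassoc_inv (U V W : lmodType K) (t : tens U (tens V W))
    : tens (tens U V) W :=
  tlift (fun u y => tlift (fun v w => tpure (tpure u v) w) y) t.

(* P (a (x) b) = (-1)^(p(a) p(b)) b (x) a *)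
Definition tswap (U : superType K) : tens U U -> tens U U :=
  tlift (fun a b => \sum_(q : bool) tpure (parity_part q b) (koszul q a)).

Variable U : superType K.
Local Notation U2 := (tens U U).
Local Notation U3 := (tens (tens U U) U).

Definition op12 (f : U2 -> U2) : U3 -> U3 := tmap f idfun.
Definition op23 (f : U2 -> U2) (t : U3) : U3 :=
  tassoc_inv (tmap idfun f (tassoc t)).
Definition op13 (f : U2 -> U2) (t : U3) : U3 :=
  op23 (@tswap U) (op12 f (op23 (@tswap U) t)).

Definition lin_indep (n : nat) (f : 'I_n -> U -> U) : Prop :=
  forall c : 'I_n -> K,
    (forall u, \sum_(i < n) c i *: f i u = 0) -> forall i, c i = 0.

(* An even element sum_i Phi_i (x) Psi_i of End(U) (x) End(U). *)
Record end_tens := EndTens {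
  rk : nat;
  Phi : 'I_rk -> {linear U -> U};
  Psi : 'I_rk -> {linear U -> U};
  par : 'I_rk -> bool;
  Phi_parity : forall i, has_parity (par i) (Phi i);
  Psi_parity : forall i, has_parity (par i) (Psi i);
  Phi_indep : lin_indep Phi;
  Psi_indep : lin_indep Psi
}.

Definition tact (S : end_tens) : U2 -> U2 :=
  tlift (fun a b =>
    \sum_(i < rk S) tpure (Phi i (koszul (par i) a)) (Psi i b)).

Record is_braiding (S : end_tens) : Prop := {
  braid_swap : forall x, tact S (tswap x) = tswap (tact S x);
  braid_12_23 : forall t,
    op12 (tact S) (op23 (tact S) t) = op23 (tact S) (op12 (tact S) t);
  braid_13_23 : forall t,
    op13 (tact S) (op23 (tact S) t) = op23 (tact S) (op13 (tact S) t);
  braid_12_13 : forall t,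
    op12 (tact S) (op13 (tact S) t) = op13 (tact S) (op12 (tact S) t)
}.

Record braiding_map := BraidingMap {
  braid_end :> end_tens;
  braidP : is_braiding braid_end
}.

End TensorMaps.

Section LogFields.
Variables (K : fieldType) (V : superType K).

(* [f n k] is the coefficient of z^n zeta^k. *)
Definition log_series := int -> nat -> V.

(* f in V((z))[zeta] *)
Definition log_laurent (f : log_series) : Prop :=
  exists (m : int) (d : nat), forall n k,
    (n < m)%R \/ (d <= k)%N -> f n k = 0.

(* f in V[[z]] *)
Definition power_series (f : log_series) : Prop :=
  forall n k, (n < 0)%R \/ (0 < k)%N -> f n k = 0.

Definition at_zero (f : log_series) : V := f 0 0%N.

Definition is_log_field (a : V -> log_series) : Prop :=
  (forall c u v n k, a (c *: u + v) n k = c *: a u n k + a v n k) /\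
  (forall v, log_laurent (a v)).

Definition log_field_pred : {pred V -> log_series} :=
  [pred a | `[< is_log_field a >]].

Lemma log_field_submod : submod_closed log_field_pred.
Proof.
split=> [|c a b].
  apply/asboolP; split=> [*|v]; first by rewrite /= scaler0 addr0.
  by exists 0, 0%N.
move=> /asboolP[la fa] /asboolP[lb fb]; apply/asboolP; split=> [e u v n k|v].
  rewrite !(fctE, scalrfctE) /= la lb !scalerDr !scalerA (mulrC e c).
  by rewrite -!addrA; congr (_ + _); rewrite addrCA.
have [m [d h]] := fa v; have [m' [d' h']] := fb v.
exists (Order.min m m'), (maxn d d') => n k hnk.
rewrite !(fctE, scalrfctE) /= h ?h' ?scaler0 ?addr0 //;
  case: hnk; rewrite ?lt_min ?geq_max => /andP[h1 h2];
  by [left | right].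
Qed.

HB.instance Definition _ :=
  GRing.isSubmodClosed.Build K (V -> log_series) log_field_pred
    log_field_submod.

Record LF := LogField {
  lf_val :> V -> log_series;
  _ : lf_val \in log_field_pred
}.

HB.instance Definition _ := [isSub for lf_val].
HB.instance Definition _ := [Choice of LF by <:].
HB.instance Definition _ := [SubChoice_isSubLmodule of LF by <:].

Lemma LF_is_log_field (a : LF) : is_log_field a.
Proof. by case: a => a /= /asboolP. Qed.

Definition mkLF (a : V -> log_series) (ha : is_log_field a) : LF :=
  LogField (introT (asboolP _) ha).

Lemma LF_ext (a b : LF) : (forall v n k, a v n k = b v n k) -> a = b.
Proof.
by move=> h; apply: val_inj; apply/funext => v; apply/funext => n;
  apply/funext => k; exact: h.
Qed.


(* a_p maps V_q to V_(p+q)((z))[zeta] *)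
Definition lf_part_fun (p : bool) (a : V -> log_series) : V -> log_series :=
  fun v n k =>
    \sum_(q : bool) parity_part (p (+) q) (a (parity_part q v) n k).

Lemma lf_part_subproof p (a : LF) : is_log_field (lf_part_fun p a).
Proof.
have [la fa] := LF_is_log_field a; split=> [c u v n k|v].
  rewrite /lf_part_fun scaler_sumr -big_split; apply: eq_bigr => q _ /=.
  by rewrite linearP la linearP.
have [m [d h]] := fa (parity_part true v).
have [m' [d' h']] := fa (parity_part false v).
exists (Order.min m m'), (maxn d d') => n k hnk.
rewrite /lf_part_fun big_bool /= h ?h' ?linear0 ?addr0 //;
  case: hnk; rewrite ?lt_min ?geq_max => /andP[h1 h2];
  by [left | right].
Qed.

Definition lf_part (p : bool) (a : LF) : LF := mkLF (lf_part_subproof p a).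

Lemma LF_linear (a : LF) n k c u v :
  a (c *: u + v) n k = c *: a u n k + a v n k.
Proof. by have [la _] := LF_is_log_field a. Qed.

Lemma LF_0 (a : LF) n k : a 0 n k = 0.
Proof.
by have := LF_linear a n k (-1) 0 0; rewrite scaler0 addr0 scaleN1r addNr.
Qed.

Lemma LF_D (a : LF) n k u v : a (u + v) n k = a u n k + a v n k.
Proof. by have := LF_linear a n k 1 u v; rewrite !scale1r. Qed.

Lemma lf_part_linear p c (a b : LF) :
  lf_part p (c *: a + b) = c *: lf_part p a + lf_part p b.
Proof.
apply: LF_ext => v n k.
rewrite [LHS]/= [RHS]/= /lf_part_fun !(fctE, scalrfctE) /lf_part_fun.
rewrite scaler_sumr -big_split; apply: eq_bigr => q _.
exact: parity_part_linear.
Qed.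

Lemma lf_partK p q (a : LF) :
  lf_part p (lf_part q a) = if p == q then lf_part q a else 0.
Proof.
apply: LF_ext => v n k.
case: eqP => [->|/eqP pq].
  rewrite /= /lf_part_fun !big_bool /=.
  by rewrite !parity_partK /= !LF_0 !linear0 ?addr0 ?add0r !parity_partK !eqxx.
rewrite /= /lf_part_fun !big_bool /=.
rewrite !parity_partK /= !LF_0 !linear0 ?addr0 ?add0r !parity_partK.
by case: p q pq => [] [] //= _; rewrite addr0.
Qed.

Lemma lf_partD (a : LF) : lf_part false a + lf_part true a = a.
Proof.
apply: LF_ext => v n k.
rewrite [LHS]/= !fctE /= /lf_part_fun !big_bool /=.
rewrite -[in RHS](parity_partD v) LF_D.
rewrite -[X in _ = X + _]parity_partD -[X in _ = _ + X]parity_partD.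
by rewrite addrACA addrC [X in _ + X]addrC -!addrA; congr (_ + _);
  rewrite addrCA.
Qed.

HB.instance Definition _ := Lmodule_isSuperspace.Build K LF
  lf_part_linear lf_partK lf_partD.

(* D_z = d/dz + z^-1 d/dzeta *)
Definition Dz_fun (a : V -> log_series) : V -> log_series :=
  fun v n k => (n + 1)%:~R *: a v (n + 1) k + k.+1%:R *: a v (n + 1) k.+1.

Lemma Dz_subproof (a : LF) : is_log_field (Dz_fun a).
Proof.
have [la fa] := LF_is_log_field a; split=> [c u v n k|v].
  by rewrite /Dz_fun !la !scalerDr !scalerA ![_ * c]mulrC addrACA.
have [m [d h]] := fa v; exists (m - 1), d => n k hnk.
rewrite /Dz_fun !h ?scaler0 ?addr0 //; case: hnk => [hn|hk].
- by left; rewrite -ltrBrDr.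
- by right; exact: leqW.
- by left; rewrite -ltrBrDr.
- by right.
Qed.

Definition Dz (a : LF) : LF := mkLF (Dz_subproof a).

(* T is even in all uses, so that [T, a(z)] = T a(z) - a(z) T. *)
Definition adT_fun (T : V -> V) (a : V -> log_series) : V -> log_series :=
  fun v n k => T (a v n k) - a (T v) n k.

Lemma adT_subproof (T : {linear V -> V}) (a : LF) :
  is_log_field (adT_fun T a).
Proof.
have [la fa] := LF_is_log_field a; split=> [c u v n k|v].
  by rewrite /adT_fun la !linearP la scalerBr opprD addrACA.
have [m [d h]] := fa v; have [m' [d' h']] := fa (T v).
exists (Order.min m m'), (maxn d d') => n k hnk.
have [h1 h2] : a v n k = 0 /\ a (T v) n k = 0.
  by split; [apply: h | apply: h']; case: hnk;
    rewrite ?lt_min ?geq_max => /andP[h1 h2]; by [left | right].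
by rewrite /adT_fun h1 h2 linear0 subr0.
Qed.

Definition adT (T : {linear V -> V}) (a : LF) : LF := mkLF (adT_subproof T a).

Definition LF_T (T : {linear V -> V}) : set LF := [set a | adT T a = Dz a].

End LogFields.

(* Series in z1, z2, zeta1, zeta2: [F m1 m2 k1 k2] is the coefficient of
   z1^m1 z2^m2 zeta1^k1 zeta2^k2.  A sum over an infinite index set below is 0
   when its support is infinite; the support is finite on the spaces named. *)
Section TwoVariables.
Variables (K : fieldType) (V : superType K).

Definition series2 := int -> int -> nat -> nat -> V.

Definition mulz12 (F : series2) : series2 :=
  fun m1 m2 k1 k2 => F (m1 - 1) m2 k1 k2 - F m1 (m2 - 1) k1 k2.

(* vartheta_12, on V((z1))((z2))[zeta1, zeta2] *)
Definition theta12 (F : series2) : series2 := fun m1 m2 k1 k2 =>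
  (if k1 is k.+1 then F m1 m2 k k2 else 0) -
  \sum_(n \in [set n : nat | (0 < n)%N])
     n%:R^-1 *: F (m1 + n%:Z) (m2 - n%:Z) k1 k2.

(* vartheta_21, on V((z2))((z1))[zeta1, zeta2] *)
Definition theta21 (F : series2) : series2 := fun m1 m2 k1 k2 =>
  (if k2 is k.+1 then F m1 m2 k1 k else 0) -
  \sum_(n \in [set n : nat | (0 < n)%N])
     n%:R^-1 *: F (m1 - n%:Z) (m2 + n%:Z) k1 k2.

(* D_(z1) = d/dz1 + z1^-1 d/dzeta1 *)
Definition Dz1 (F : series2) : series2 := fun m1 m2 k1 k2 =>
  (m1 + 1)%:~R *: F (m1 + 1) m2 k1 k2 + k1.+1%:R *: F (m1 + 1) m2 k1.+1 k2.

(* D_(z1)^(j) *)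
Definition Dz1_divpow (j : int) (F : series2) : series2 :=
  match j with
  | Posz k => k`!%:R^-1 *: iter k Dz1 F
  | Negz _ => 0
  end.

(* z1 = z2 = z and zeta1 = zeta2 = zeta, on series with finitely many powers
   of the zeta's and with exponents of z1 and z2 bounded below *)
Definition diag (F : series2) : log_series V := fun m k =>
  \sum_(i \in [set: int]) \sum_(j < k.+1) F i (m - i) j (k - j)%N.

(* mu (a(z1) (x) b(z2)) v = a(z1) b(z2) v *)
Definition mu12 (x : tens (LF V) (LF V)) (v : V) : series2 :=
  tlift (fun a b : LF V =>
    (fun m1 m2 k1 k2 => a (b v m2 k2) m1 k1) : series2) x.

(* mu (b(z2) (x) a(z1)) v = b(z2) a(z1) v *)
Definition mu21 (x : tens (LF V) (LF V)) (v : V) : series2 :=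
  tlift (fun b a : LF V =>
    (fun m1 m2 k1 k2 => b (a v m1 k1) m2 k2) : series2) x.

Variable S : end_tens (LF V).

(* mu (e^(vartheta_12 S) x(z1, z2)) v; only finitely many terms are nonzero
   when some power of S kills x *)
Definition mu_exp12 (x : tens (LF V) (LF V)) (v : V) : series2 :=
  \sum_(k \in [set: nat])
     k`!%:R^-1 *: iter k theta12 (mu12 (iter k (tact S) x) v).

(* mu (e^(vartheta_21 S) x(z2, z1)) v *)
Definition mu_exp21 (x : tens (LF V) (LF V)) (v : V) : series2 :=
  \sum_(k \in [set: nat])
     k`!%:R^-1 *: iter k theta21 (mu21 (iter k (tact S) x) v).

(* The sign (-1)^(p(a) p(b)) of the locality condition is the one in
   P (a (x) b) = (-1)^(p(a) p(b)) b (x) a. *)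
Definition local_at (N : nat) (a b : LF V) : Prop :=
  forall v, iter N mulz12 (mu_exp12 (tpure a b) v) =
            iter N mulz12 (mu_exp21 (tswap (tpure a b)) v).

Record is_local (A : set (LF V)) : Prop := {
  local_subspace : subspace A;
  local_Phi : forall (i : 'I_(rk S)) a, A a -> A (Phi i a);
  local_Psi : forall (i : 'I_(rk S)) a, A a -> A (Psi i a);
  local_nilp : forall a b, A a -> A b ->
    exists2 r, (0 < r)%N & iter r (tact S) (tpure a b) = 0;
  local_comm : forall a b, A a -> A b -> exists N, local_at N a b
}.

(* a_(n+S) b, which does not depend on the choice of N *)
Definition nprod (n : int) (a b : LF V) : LF V :=
  xget (0 : LF V) [set c : LF V | exists2 N, local_at N a b &
    forall v, c v = diag (Dz1_divpow (N%:Z - 1 - n)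
                            (iter N mulz12 (mu_exp12 (tpure a b) v)))].

(* mu^_(n) on A (x) A and mu^_(n) (x) I on A (x) A (x) A, for A S-local *)
Definition hatmu (A : set (LF V)) (n : int) :
    tens (LF V) (LF V) -> LF V :=
  tlift_on A A (nprod n).

Definition hatmuI (A : set (LF V)) (n : int) :
    tens (tens (LF V) (LF V)) (LF V) -> tens (LF V) (LF V) :=
  tlift_on (tspan A A) A (fun x c => tpure (hatmu A n x) c).

End TwoVariables.

(* The braiding map is defined on all of LF(V); it restricts to Y_z(V) by
   [local_Phi] and [local_Psi], and the conditions relating it to T, D_z and
   the products are imposed on tensor powers of Y_z(V). *)
Record is_log_vertex_algebra (K : fieldType) (V : superType K) (vac : V)
    (T : {linear V -> V}) (Y : {linear V -> LF V})
    (S : braiding_map (LF V)) : Prop := {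
  lva_vac_even : homogeneous false vac;
  lva_T_even : has_parity false T;
  lva_Y_even : has_parity false Y;
  lva_Y_vac : forall v n k,
    Y vac v n k = if (n == 0) && (k == 0%N) then v else 0;
  lva_Y_power_series : forall a, power_series (Y a vac);
  lva_Y_at_zero : forall a, at_zero (Y a vac) = a;
  lva_T_vac : T vac = 0;
  lva_adT : forall x, tspan (range Y) (range Y) x ->
    tmap (adT T) idfun (tact S x) = tact S (tmap (adT T) idfun x);
  lva_Dz : forall x, tspan (range Y) (range Y) x ->
    tmap (@Dz K V) idfun (tact S x) = tact S (tmap (@Dz K V) idfun x);
  lva_covariance : forall a, adT T (Y a) = Dz (Y a);
  lva_local : is_local S (range Y);
  lva_hexagon : forall (n : int) t,
    tspan (tspan (range Y) (range Y)) (range Y) t ->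
    tact S (hatmuI S (range Y) n t) =
    hatmuI S (range Y) n (op13 (tact S) t + op23 (tact S) t)
}.

(* Main.v *)
(* For x = a (x) b write E(x) = mu(e^(theta_12 S) x) 1 and m(x) = a(z) b_0 with
   b_0 = b(z)1 at z = 0.  Fields of LF_T map the vacuum to log-free power
   series, so locality, applied to the vacuum, equates z_12^N E(x), which has
   no zeta_2 and no negative power of z_2, with z_12^N times the flip of
   E(P x), which has no zeta_1.  Hence E(x) has no logarithms.  Its value
   at z_2 = 0 is e^(zeta S) m(x), so d/dzeta m(x) = - m(S x), and m(x) = 0
   forces m(S^j x) = 0 for all j.  By translation covariance E(x) is
   determined by its value at z_2 = 0, so then E(S^j x) = 0 for all j.
   If c in U has c_0 = 0 and b = Y(v), then m(P(c (x) b)) = 0, hence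
   E(S^j P(c (x) b)) = 0, by locality E(S^j (c (x) b)) = 0, and finally
   c(z) v = 0.  Apply this to c = a - Y(a_0). *)
Require Import Defs.
From mathcomp Require Import all_boot all_order all_algebra.
From mathcomp Require Import boolp classical_sets functions fsbigop.
From mathcomp Require Import reals complex.
From mathcomp Require Import zify.

Set Implicit Arguments.
Unset Strict Implicit.
Unset Printing Implicit Defensive.

Import Order.TTheory GRing.Theory Num.Theory.
Local Open Scope classical_set_scope.
Local Open Scope ring_scope.

(** * Convolution with an exponential, and finite sums *)

(** The system is triangular: the term i = 0 is A j k and all others have a smaller second index.
    With A j k the zeta^k coefficient of m(S^j x), this inverts e^(zeta S). *)
Lemma convolution_eq0 (K : fieldType) (V : lmodType K) (A : nat -> nat -> V) :
  (forall j k, \sum_(i < k.+1) i`!%:R^-1 *: A (j + i)%N (k - i)%N = 0) ->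
  forall j k, A j k = 0.
Proof.
move=> h j k; elim/ltn_ind: k j => k IH j.
have := h j k; rewrite big_ord_recl big1 => [|i _].
  by rewrite addr0 fact0 invr1 scale1r addn0 subn0.
by rewrite IH ?scaler0 //= /bump; have := ltn_ord i; lia.
Qed.

(** Differentiation in zeta: d/dzeta (e^(zeta S) M) = e^(zeta S) (M' + S M), where S raises the
    first index of M, and [convolution_eq0] removes the exponential. *)
Lemma convolution_deriv (K : numFieldType) (V : lmodType K)
    (M : nat -> nat -> V) :
  (forall j k, \sum_(i < k.+2) i`!%:R^-1 *: M (j + i)%N (k.+1 - i)%N = 0) ->
  forall j k, k.+1%:R *: M j k.+1 + M j.+1 k = 0.
Proof.
move=> h; apply: convolution_eq0 => j k.
have := congr1 (fun v => k.+1%:R *: v) (h j k); rewrite /= scaler0.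
rewrite scaler_sumr => H0; rewrite -[RHS]H0.
under eq_bigr => i _ do rewrite scalerDr.
rewrite big_split /=.
(* Leibniz rule through k+1 = (k+1-i) + i: the first part differentiates M, the second the
   exponential. *)
have E (i : 'I_k.+2) : k.+1%:R *: (i`!%:R^-1 *: M (j + i)%N (k.+1 - i)%N) =
   i`!%:R^-1 *: ((k.+1 - i)%:R *: M (j + i)%N (k.+1 - i)%N)
   + i%:R *: (i`!%:R^-1 *: M (j + i)%N (k.+1 - i)%N).
  rewrite !scalerA -scalerDl; congr (_ *: _).
  by rewrite [_^-1 * _]mulrC -mulrDl -natrD subnK // -ltnS.
rewrite (eq_bigr _ (fun i _ => E i)) big_split /=; congr (_ + _).
  rewrite [RHS]big_ord_recr /= subnn scale0r scaler0 addr0.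
  by apply: eq_bigr => i _; rewrite subSn // -ltnS.
rewrite [RHS]big_ord_recl /= scale0r add0r; apply: eq_bigr => i _.
rewrite /bump /= add1n subSS addnS scalerA factS natrM invfM mulrA.
by rewrite divff ?mul1r // pnatr_eq0.
Qed.

Lemma sum_ord_widen (V : nmodType) (f : nat -> V) (a b : nat) :
  (a <= b)%N -> (forall n, (a <= n)%N -> f n = 0) ->
  \sum_(n < a) f n = \sum_(n < b) f n.
Proof.
move=> ab f0; rewrite (big_ord_widen _ _ ab) big_mkcond; apply: eq_bigr => i _.
by case: ltnP => // /f0 ->.
Qed.

Lemma addr_shuffle (V : zmodType) (a b c d f s4 s3 s2 s1 : V) :
    a - s4 + (b + f - s3) + (c - s2 + (d - s1)) =
    a + b + (c + d) + (f + (- (s4 + s3) - (s2 + s1))).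
Proof.
rewrite !opprD [a - _ + _]addrACA [c - _ + _]addrACA [LHS]addrACA.
by rewrite (addrA a) (addrAC (a + b)) -[LHS]addrA.
Qed.

Lemma fsbig_nat_trunc (V : nmodType) (f g : nat -> V) r :
  (forall k, f k = g k) -> (forall k, (r <= k)%N -> g k = 0) ->
  \sum_(k \in [set: nat]) f k = \sum_(k < r) g k.
Proof.
move=> /funext -> g0; rewrite fsbig_ord; apply/esym/fsbig_widen => // k [_] /=.
by move/negP; rewrite -leqNgt => /g0.
Qed.

Section LinearMaps.
Variables (K : pzRingType) (V W : lmodType K) (f : V -> W).
Hypothesis fL : forall c x y, f (c *: x + y) = c *: f x + f y.

Lemma linear_map0 : f 0 = 0.
Proof. by have := fL (-1) 0 0; rewrite scaler0 addr0 scaleN1r addNr. Qed.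

Lemma linear_mapD x y : f (x + y) = f x + f y.
Proof. by have := fL 1 x y; rewrite !scale1r. Qed.

End LinearMaps.

(** * Series in two variables: z_12, vartheta_12 and D_(z1) + D_(z2) *)

Section Series2.
Variables (K : fieldType) (V : superType K).
Implicit Types F G : series2 V.

Definition flip F : series2 V := fun m1 m2 k1 k2 => F m2 m1 k2 k1.

Lemma series2_sumE (I : Type) (r : seq I) (P : pred I) (F : I -> series2 V)
    m1 m2 k1 k2 :
  (\sum_(i <- r | P i) F i) m1 m2 k1 k2 = \sum_(i <- r | P i) F i m1 m2 k1 k2.
Proof. by rewrite !fct_sumE. Qed.

Lemma mulz12_linear c F G :
  mulz12 (c *: F + G : series2 V) = (c *: mulz12 F + mulz12 G : series2 V).
Proof.
apply/funext => m1; apply/funext => m2; apply/funext => k1; apply/funext => k2.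
rewrite /mulz12 !(fctE, scalrfctE) /= scalerBr.
by rewrite opprD addrACA.
Qed.

Lemma iter_mulz12_linear N c F G :
  iter N (@mulz12 K V) (c *: F + G : series2 V) =
  (c *: iter N (@mulz12 K V) F + iter N (@mulz12 K V) G : series2 V).
Proof. by elim: N => //= N ->; exact: mulz12_linear. Qed.

Lemma iter_mulz12_supp N F k1 k2 :
  (forall m1 m2, m2 < 0 -> F m1 m2 k1 k2 = 0) ->
  forall m1 m2, m2 < 0 -> iter N (@mulz12 K V) F m1 m2 k1 k2 = 0.
Proof.
move=> h; elim: N => [|N IH] m1 m2 hm /=; first exact: h.
by rewrite /mulz12 !IH ?subr0 //; lia.
Qed.

Lemma iter_mulz12_slice N F k1 k2 : (forall m1 m2, F m1 m2 k1 k2 = 0) ->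
  forall m1 m2, iter N (@mulz12 K V) F m1 m2 k1 k2 = 0.
Proof.
by move=> h; elim: N => [|N IH] m1 m2 //=; rewrite /mulz12 !IH subr0.
Qed.

(** The coefficient of z_12 G at (m1 + 1, m2) is G at (m1, m2) minus G at (m1 + 1, m2 - 1). Since G
    vanishes for m2 < 0, induction on m2 recovers G. *)
Lemma iter_mulz12_inj N F k1 k2 : (forall m1 m2, m2 < 0 -> F m1 m2 k1 k2 = 0) ->
  (forall m1 m2, iter N (@mulz12 K V) F m1 m2 k1 k2 = 0) ->
  forall m1 m2, F m1 m2 k1 k2 = 0.
Proof.
move=> h0; elim: N => [|N IH] //= h; apply: IH => m1 m2.
have hs := @iter_mulz12_supp N F k1 k2 h0.
set G := iter _ _ _ in h hs *.
have [|m2_ge0] := ltP m2 0; first exact: hs.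
rewrite -(gez0_abs m2_ge0); elim: `|m2|%N m1 => [|n IHn] m1.
  have := h (m1 + 1) 0; rewrite /mulz12 (hs _ (0 - 1)) // subr0.
  by rewrite (_ : m1 + 1 - 1 = m1) //; lia.
have := h (m1 + 1) n.+1; rewrite /mulz12.
rewrite (_ : m1 + 1 - 1 = m1); last lia.
by rewrite (_ : Posz n.+1 - 1 = n) ?IHn ?subr0 //; lia.
Qed.

(* [theta12] truncated to the terms that matter on series with no negative
   powers of z2. *)
Definition theta12_fin F : series2 V := fun m1 m2 k1 k2 =>
  (if k1 is k.+1 then F m1 m2 k k2 else 0) -
  \sum_(n < `|m2|%N) n.+1%:R^-1 *: F (m1 + n.+1%:Z) (m2 - n.+1%:Z) k1 k2.

(** The shape of a(z_1) b(z_2) 1 when b(z) 1 is a power series without logarithms. *)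
Definition z2_regular F : Prop :=
  forall m1 m2 k1 k2, (m2 < 0)%R \/ (0 < k2)%N -> F m1 m2 k1 k2 = 0.

Lemma theta12_finE F : z2_regular F -> theta12 F = theta12_fin F.
Proof.
move=> h.
apply/funext => m1; apply/funext => m2; apply/funext => k1; apply/funext => k2.
rewrite /theta12 /theta12_fin; congr (_ - _).
pose f n := n%:R^-1 *: F (m1 + n%:Z) (m2 - n%:Z) k1 k2.
(* As the inverse of 0 is 0, the term n = 0 vanishes and can be adjoined to the sum. *)
have f0 : f 0%N = 0 by rewrite /f invr0 scale0r.
have -> : \sum_(n < `|m2|%N) n.+1%:R^-1 *: F (m1 + n.+1%:Z) (m2 - n.+1%:Z) k1 k2
    = \sum_(n < `|m2|%N.+1) f n.
  by rewrite big_ord_recl f0 add0r.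
rewrite (fsbig_ord _ _ f).
rewrite (@fsbig_widen _ _ _ _ [set n | (0 < n)%N] setT) //; last first.
  by case=> [|n] [_] //= [].
apply/esym/fsbig_widen => // n [_] /= /negP; rewrite -leqNgt => hn.
by rewrite /f h ?scaler0 //; left; lia.
Qed.

Lemma theta12_fin_linear c F G :
  theta12_fin (c *: F + G : series2 V) =
  (c *: theta12_fin F + theta12_fin G : series2 V).
Proof.
apply/funext => m1; apply/funext => m2; apply/funext => k1; apply/funext => k2.
rewrite /theta12_fin !(fctE, scalrfctE) /= scalerBr scaler_sumr.
rewrite addrACA -opprD -big_split /=; congr (_ - _).
  by case: k1 => [|k1] //; rewrite scaler0 addr0.
by apply: eq_bigr => i _; rewrite scalerDr !scalerA mulrC.
Qed.

Lemma theta12_fin_regular F : z2_regular F -> z2_regular (theta12_fin F).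
Proof.
move=> h m1 m2 k1 k2 hmk; rewrite /theta12_fin big1 ?subr0 => [|i _].
  by case: k1 => // k1; exact: h.
by rewrite h ?scaler0 //; case: hmk; [left; lia | right].
Qed.

Lemma iter_theta12_fin_linear k c F G :
  iter k theta12_fin (c *: F + G : series2 V) =
  (c *: iter k theta12_fin F + iter k theta12_fin G : series2 V).
Proof. by elim: k => //= k ->; exact: theta12_fin_linear. Qed.

Lemma iter_theta12_fin_regular k F :
  z2_regular F -> z2_regular (iter k theta12_fin F).
Proof. by move=> h; elim: k => //= k; exact: theta12_fin_regular. Qed.

Lemma iter_theta12_finE k F :
  z2_regular F -> iter k (@theta12 K V) F = iter k theta12_fin F.
Proof.
move=> h; elim: k => //= k ->; apply: theta12_finE.
exact: iter_theta12_fin_regular.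
Qed.

Lemma iter_theta12_fin0 k : iter k theta12_fin (0 : series2 V) = 0.
Proof. exact: (linear_map0 (iter_theta12_fin_linear k)). Qed.

(** At z_2 = 0 the sum in vartheta_12 drops out and only multiplication by zeta_1 remains. *)
Lemma iter_theta12_fin_z20 i F m k1 k2 :
  iter i theta12_fin F m 0 k1 k2 =
  if (i <= k1)%N then F m 0 (k1 - i)%N k2 else 0.
Proof.
elim: i k1 => [|i IH] k1 /=; first by rewrite subn0.
by rewrite /theta12_fin big_ord0 subr0; case: k1.
Qed.

(** This is D_(z1) + D_(z2), by which T acts on a(z_1) b(z_2) 1 for translation covariant a and
    b. *)
Definition Dz12 F : series2 V := fun m1 m2 k1 k2 =>
  (m1 + 1)%:~R *: F (m1 + 1) m2 k1 k2 + k1.+1%:R *: F (m1 + 1) m2 k1.+1 k2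
  + ((m2 + 1)%:~R *: F m1 (m2 + 1) k1 k2 + k2.+1%:R *: F m1 (m2 + 1) k1 k2.+1).

Lemma theta12_fin_trunc (N : nat) F (m1 m2 : int) k1 k2 :
  z2_regular F -> (m2 <= N)%R ->
  theta12_fin F m1 m2 k1 k2 = (if k1 is k.+1 then F m1 m2 k k2 else 0) -
  \sum_(n < N) n.+1%:R^-1 *: F (m1 + n.+1%:Z) (m2 - n.+1%:Z) k1 k2.
Proof.
move=> h hN; rewrite /theta12_fin; congr (_ - _).
pose f n := n.+1%:R^-1 *: F (m1 + n.+1%:Z) (m2 - n.+1%:Z) k1 k2.
(* The witness is max(m2, 0): from this index on, the exponent m2 - (n + 1) is negative. *)
have [a [ha aN am]] : exists a : nat,
    [/\ m2 <= a%:Z, (a <= N)%N & (a <= `|m2|)%N].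
  by case: m2 hN {f} => n hN; [exists n | exists 0%N].
have f0 n : (a <= n)%N -> f n = 0.
  by move=> an; rewrite /f h ?scaler0 //; left; lia.
by rewrite -(sum_ord_widen am f0) (sum_ord_widen aN f0).
Qed.

Lemma Dz12_regular F : z2_regular F -> z2_regular (Dz12 F).
Proof.
move=> h m1 m2 k1 k2 hmk; rewrite /Dz12 !(h (m1 + 1)) // !scaler0 addr0 add0r.
rewrite [X in _ + _ *: X]h ?scaler0 ?addr0; last by right.
(* At m2 = -1 the shifted exponent is 0, where F may be nonzero, but the factor m2 + 1 vanishes. *)
have [->|m2N1] := eqVneq m2 (-1); first by rewrite addNr scale0r.
by rewrite h ?scaler0 //; case: hmk; [left; lia | right].
Qed.

Lemma Dz12_linear c F G :
  Dz12 (c *: F + G : series2 V) = (c *: Dz12 F + Dz12 G : series2 V).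
Proof.
apply/funext => m1; apply/funext => m2; apply/funext => k1; apply/funext => k2.
rewrite /Dz12 !(fctE, scalrfctE) /= !scalerDr !scalerA ![_ * c]mulrC.
by rewrite [X in X + _ = _]addrACA [X in _ + X = _]addrACA [LHS]addrACA.
Qed.

End Series2.

(* This holds because D_(z1) + D_(z2) kills vartheta_12. *)
Lemma Dz12_theta12 (K : numFieldType) (V : superType K) (F : series2 V) :
  z2_regular F -> Dz12 (theta12_fin F) = theta12_fin (Dz12 F).
Proof.
move=> h.
apply/funext => m1; apply/funext => m2; apply/funext => k1; apply/funext => k2.
pose N := `|m2|%N.+1.
have hD : z2_regular (Dz12 F) by exact: Dz12_regular.
have hs (G : series2 V) n1 n2 l1 l2 : z2_regular G -> n2 <= m2 + 1 ->
    theta12_fin G n1 n2 l1 l2 = (if l1 is k.+1 then G n1 n2 k l2 else 0) -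
      \sum_(n < N) n.+1%:R^-1 *: G (n1 + n.+1%:Z) (n2 - n.+1%:Z) l1 l2.
  by move=> hG hn; apply: theta12_fin_trunc => //; rewrite /N; lia.
rewrite (hs _ _ _ _ _ hD); last by rewrite lerDl.
rewrite [LHS]/Dz12 !(hs F) ?lerDl // => {hs hD}.
pose g n := F (m1 + 1 + n%:Z) (m2 - n%:Z) k1 k2.
have gN : g N = 0 by rewrite /g h //; left; rewrite /N; lia.
(* Replacing the weights of D_(z1) and D_(z2) by m1 + 1 and m2 + 1 leaves n + 1 and -(n + 1), which
   1/(n + 1) cancels. The leftovers telescope to minus [g 0], matching D_(z1) zeta_1 = z_1^-1. *)
have X n : n.+1%:R^-1 *: Dz12 F (m1 + n.+1%:Z) (m2 - n.+1%:Z) k1 k2 =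
   (m1 + 1)%:~R *: (n.+1%:R^-1 *: F (m1 + 1 + n.+1%:Z) (m2 - n.+1%:Z) k1 k2) +
   k1.+1%:R *: (n.+1%:R^-1 *: F (m1 + 1 + n.+1%:Z) (m2 - n.+1%:Z) k1.+1 k2) +
   ((m2 + 1)%:~R *: (n.+1%:R^-1 *: F (m1 + n.+1%:Z) (m2 + 1 - n.+1%:Z) k1 k2) +
   k2.+1%:R *: (n.+1%:R^-1 *: F (m1 + n.+1%:Z) (m2 + 1 - n.+1%:Z) k1 k2.+1)) +
   (g n.+1 - g n).
  rewrite /Dz12 /g.
  have -> : m1 + n.+1%:Z + 1 = m1 + 1 + n.+1%:Z by lia.
  have -> : m2 - n.+1%:Z + 1 = m2 - n%:Z by lia.
  have -> : m1 + 1 + n%:Z = m1 + n.+1%:Z by lia.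
  have -> : m2 + 1 - n.+1%:Z = m2 - n%:Z by lia.
  have nn : (n.+1%:R : K) != 0 by rewrite pnatr_eq0.
  have ea : (n.+1%:R^-1 : K) * (m1 + 1 + n.+1%:Z)%:~R =
      (m1 + 1)%:~R * n.+1%:R^-1 + 1.
    by rewrite [in LHS]intrD mulrDr pmulrn mulVf ?pmulrn // mulrC.
  have ec : (n.+1%:R^-1 : K) * (m2 - n%:Z)%:~R =
      (m2 + 1)%:~R * n.+1%:R^-1 - 1.
    have -> : m2 - n%:Z = m2 + 1 - n.+1%:Z by lia.
    by rewrite [in LHS]intrB mulrBr pmulrn mulVf ?pmulrn // mulrC.
  rewrite !scalerDr !scalerA ea ec scalerBl scalerDl !scale1r.
  rewrite ![n.+1%:R^-1 * _]mulrC [RHS]addrACA; congr (_ + _).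
    by rewrite addrAC.
  by rewrite addrAC.
under [in RHS]eq_bigr => n _ do rewrite X.
rewrite big_split /= -(big_mkord xpredT (fun n => g n.+1 - g n)).
rewrite telescope_sumr // gN sub0r !big_split /= -!scaler_sumr.
have -> : g 0%N = F (m1 + 1) m2 k1 k2 by rewrite /g addr0 subr0.
move: (\sum_(i < N) _) (\sum_(i < N) _) (\sum_(i < N) _) (\sum_(i < N) _).
move=> s1 s2 s3 s4.
have -> : (if k1 is k.+1 then Dz12 F m1 m2 k k2 else 0) =
  (m1 + 1)%:~R *: (if k1 is k.+1 then F (m1 + 1) m2 k k2 else 0) +
  k1%:R *: F (m1 + 1) m2 k1 k2 +
  ((m2 + 1)%:~R *: (if k1 is k.+1 then F m1 (m2 + 1) k k2 else 0) +
   k2.+1%:R *: (if k1 is k.+1 then F m1 (m2 + 1) k k2.+1 else 0)).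
  by case: k1 {X g gN s1 s2 s3 s4} => // ; rewrite !scaler0 scale0r !addr0.
rewrite !scalerBr opprB opprD.
rewrite -[k1.+1]addn1 natrD scalerDl scale1r.
exact: addr_shuffle.
Qed.

(** * Translation covariant fields on the vacuum *)

Section VacuumSeries.
Variables (K : numFieldType) (V : superType K).

(** On polynomials in zeta, c + d/dzeta with c nonzero is injective, by descent from the top degree.
    Taking [k0] = 1 restricts the argument to the terms with logarithms. *)
Lemma descending_eq0 (c : K) (u : nat -> V) d k0 : c != 0 ->
  (forall k, (k0 <= k)%N -> c *: u k + k.+1%:R *: u k.+1 = 0) ->
  (forall k, (d <= k)%N -> u k = 0) -> forall k, (k0 <= k)%N -> u k = 0.
Proof.
move=> c0 hrec hd k hk.
suff h j : forall k, (k0 <= k)%N -> (d <= k + j)%N -> u k = 0.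
  by apply: (h d) => //; rewrite leq_addl.
elim: j => [|j IH] {hk}k hk dk; first by apply: hd; rewrite -[k]addn0.
have := hrec k hk; rewrite (IH k.+1) ?scaler0 ?addr0; last 2 first.
- exact: leqW.
- by rewrite addSnnS.
by move/eqP; rewrite scaler_eq0 (negbTE c0) => /eqP.
Qed.

(** As T kills the vacuum, covariance reads T(a(z) 1) = D_z(a(z) 1), a recursion on the exponent n
    that starts below the support. On the coefficient of z^n, a polynomial in zeta, D_z acts as n +
    d/dzeta. *)
Lemma translation_covariant_vac (vac : V) (T : {linear V -> V}) (a : LF V) :
  T vac = 0 -> LF_T T a -> power_series (a vac).
Proof.
move=> T0 aT.
have hrec n k : (n + 1)%:~R *: a vac (n + 1) k + k.+1%:R *: a vac (n + 1) k.+1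
    = T (a vac n k).
  have := congr1 (fun b : LF V => b vac n k) aT.
  by rewrite /= /adT_fun /Dz_fun T0 LF_0 subr0.
have [_ /(_ vac) [m [d had]]] := LF_is_log_field a.
have neg n k : n < 0 -> a vac n k = 0.
  suff h j : forall n k, n < 0 -> n < m + j%:Z -> a vac n k = 0.
    by move=> n0; apply: (h `|n - m|%N.+1) => //; lia.
  elim: j => [|j IH] {}n {}k n0 nm.
    by apply: had; left; rewrite -[m]addr0.
  apply: (@descending_eq0 n%:~R (a vac n) d 0) => //.
  - by rewrite intr_eq0 lt_eqF.
  - move=> k' _; have := hrec (n - 1) k'; rewrite subrK => ->.
    by rewrite IH ?linear0 //; lia.
  - by move=> k' dk; apply: had; right.
move=> n k; have [n0 _|n0 []] := ltP n 0; rewrite ?[n < 0]ltNge ?n0 //.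
  exact: neg.
rewrite -(gez0_abs n0); elim: `|n|%N k => [|i IH] k.
  (* At n = 0 the weight vanishes and d/dzeta alone is left, so the logarithms vanish while the
     constant term stays free. *)
  case: k => // k _; have := hrec (-1) k; rewrite addNr scale0r add0r.
  rewrite (neg (-1)) //.
  by rewrite linear0 => /eqP; rewrite scaler_eq0 pnatr_eq0 => /eqP.
apply: (@descending_eq0 (i%:Z + 1)%:~R (a vac i.+1) d 1) => //.
- by rewrite intr_eq0; lia.
- move=> k' hk'; have := hrec i k'.
  by rewrite IH // linear0 (_ : i%:Z + 1 = i.+1) //; lia.
- by move=> k' dk; apply: had; right.
Qed.

End VacuumSeries.

(** * Parity and the Koszul sign *)

Section Superspaces.
Variables (K : fieldType) (V : superType K).

Lemma koszul_linear p c (u v : V) :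
  koszul p (c *: u + v) = c *: koszul p u + koszul p v.
Proof.
rewrite /koszul !linearP /= !scalerDr !scalerA.
by rewrite (mulrC c) addrACA.
Qed.

Lemma subspace_addscale (A : set V) : subspace A ->
  (forall u v, A u -> A v -> A (u + v)) /\ (forall c u, A u -> A (c *: u)).
Proof.
case=> A0 AL _; split=> [u v|c u] Au; first by rewrite -[u]scale1r; exact: AL.
by rewrite -[_ *: _]addr0; exact: AL.
Qed.

Lemma koszul_subspace (A : set V) p u : subspace A -> A u -> A (koszul p u).
Proof.
move=> sA Au; have [AD AZ] := subspace_addscale sA; case: sA => _ _ Ap.
by apply: AD; [|apply: AZ]; exact: Ap.
Qed.

End Superspaces.

(** * Tensors with factors in a subspace; linearity of S and P *)

Section TensorSpan.
Variables (K : fieldType) (U : superType K) (A : set U).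
Implicit Types x y t : tens U U.

Lemma tspan_ind (P : tens U U -> Prop) : P 0 ->
  (forall a b x, A a -> A b -> tspan A A x -> P x -> P (tpure a b + x)) ->
  forall t, tspan A A t -> P t.
Proof.
move=> P0 PD t [s hs ->]; rewrite /fsum.
elim: s hs => [|p s IH] hs; first by rewrite big_nil.
have [Aa Ab] := hs p (mem_head _ _).
have hs' q : q \in s -> A q.1 /\ A q.2.
  by move=> qs; apply: hs; rewrite inE qs orbT.
by rewrite big_cons; apply: PD => //; [exists s | exact: IH].
Qed.

Lemma tspan0 : tspan A A (0 : tens U U).
Proof. by exists [::]; rewrite /fsum ?big_nil. Qed.

Lemma tspan_pure a b : A a -> A b -> tspan A A (tpure a b).
Proof.
move=> Aa Ab; exists [:: (a, b)]; rewrite /fsum ?big_seq1 //.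
by move=> p; rewrite inE => /eqP ->.
Qed.

Lemma tspanD x y : tspan A A x -> tspan A A y -> tspan A A (x + y).
Proof.
move=> [s hs ->] [t ht ->]; exists (s ++ t); last by rewrite /fsum big_cat.
by move=> p; rewrite mem_cat => /orP[/hs|/ht].
Qed.

Lemma tspan_sum (I : Type) (r : seq I) (F : I -> tens U U) :
  (forall i, tspan A A (F i)) -> tspan A A (\sum_(i <- r) F i).
Proof. by move=> h; elim/big_ind: _ => //; [exact: tspan0 | exact: tspanD]. Qed.

Lemma tact_bilin (S : end_tens U) : bilin (fun a b : U =>
  \sum_(i < rk S) tpure (Phi i (koszul (par i) a)) (Psi i b)).
Proof.
have [h1 h2] := tpure_bilin U U.
split=> [c u u' w|c u w w'];
  rewrite scaler_sumr -big_split; apply: eq_bigr => i _ /=.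
  by rewrite koszul_linear linearP h1.
by rewrite linearP h2.
Qed.

Lemma tact_linear (S : end_tens U) c x y :
  tact S (c *: x + y) = c *: tact S x + tact S y.
Proof. exact/tlift_linear/tact_bilin. Qed.

Lemma tswap_bilin : bilin (fun a b : U =>
  \sum_(q : bool) tpure (parity_part q b) (koszul q a)).
Proof.
have [h1 h2] := tpure_bilin U U.
split=> [c u u' w|c u w w'];
  rewrite scaler_sumr -big_split; apply: eq_bigr => i _ /=.
  by rewrite koszul_linear h2.
by rewrite linearP h1.
Qed.

Lemma tswap_linear c x y :
  tswap (c *: x + y) = c *: tswap x + tswap y.
Proof. exact/tlift_linear/tswap_bilin. Qed.

End TensorSpan.

Lemma LF_addscaleE (K : fieldType) (V : superType K) (a b : LF V) c v n k :
  (a + c *: b) v n k = a v n k + c *: b v n k.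
Proof. by []. Qed.

(** * The series E(x) of a local space, applied to the vacuum *)

Section Local.
Variables (K : numFieldType) (V : superType K) (vac : V).
Variables (T : {linear V -> V}) (S : end_tens (LF V)) (U : set (LF V)).
Hypotheses (T0 : T vac = 0) (UT : U `<=` LF_T T) (SU : is_local S U).

Local Notation UU := (tspan U U).
Local Notation flip := (@flip K V).

Lemma mu12_bilin (v : V) : bilin (fun a b : LF V =>
  (fun m1 m2 k1 k2 => a (b v m2 k2) m1 k1) : series2 V).
Proof.
split=> [c a a' b|c a b b'].
  by [].
apply/funext => m1; apply/funext => m2; apply/funext => k1; apply/funext => k2.
exact: (LF_linear a m1 k1 c (b v m2 k2) (b' v m2 k2)).
Qed.

Lemma mu12_linear v c (x y : tens (LF V) (LF V)) :
  mu12 (c *: x + y) v = (c *: mu12 x v + mu12 y v : series2 V).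
Proof. by rewrite /mu12 (tlift_linear (mu12_bilin v)). Qed.

Lemma mu12_pure v (a b : LF V) m1 m2 k1 k2 :
  mu12 (tpure a b) v m1 m2 k1 k2 = a (b v m2 k2) m1 k1.
Proof. by rewrite /mu12 (tlift_pure _ _ (mu12_bilin v)). Qed.

Lemma mu12_0 v : mu12 (0 : tens (LF V) (LF V)) v = 0.
Proof. exact: (linear_map0 (mu12_linear v)). Qed.

Lemma mu12D v x y : mu12 (x + y) v = (mu12 x v + mu12 y v : series2 V).
Proof. exact: (linear_mapD (mu12_linear v)). Qed.

Lemma mu21_flip x v : mu21 x v = flip (mu12 x v).
Proof.
apply/funext => m1; apply/funext => m2; apply/funext => k1; apply/funext => k2.
by rewrite /flip /mu21 /mu12 /tlift /fsum !series2_sumE.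
Qed.

Lemma tact_span x : UU x -> UU (tact S x).
Proof.
move: x; apply: tspan_ind => [|a b x Ua Ub _ IH].
  by rewrite (linear_map0 (tact_linear S)); exact: tspan0.
rewrite (linear_mapD (tact_linear S)).
apply: tspanD => //; rewrite /tact (tlift_pure _ _ (tact_bilin S)).
apply: tspan_sum => i; apply: tspan_pure.
  by apply: (local_Phi SU); exact: (koszul_subspace _ (local_subspace SU)).
exact: (local_Psi SU).
Qed.

Lemma iter_tact_span k x : UU x -> UU (iter k (tact S) x).
Proof. by move=> Ux; elim: k => //= k; exact: tact_span. Qed.

Lemma iter_tact_linear k c x y : iter k (tact S) (c *: x + y) =
  c *: iter k (tact S) x + iter k (tact S) y.
Proof. by elim: k => //= k ->; exact: tact_linear. Qed.

Lemma iter_tact0 k : iter k (tact S) 0 = 0.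
Proof. exact: (linear_map0 (iter_tact_linear k)). Qed.

Lemma iter_tact_le r r' x : (r <= r')%N -> iter r (tact S) x = 0 ->
  iter r' (tact S) x = 0.
Proof. by move=> /subnK <- h; rewrite iterD h iter_tact0. Qed.

Lemma tact_nilp x : UU x -> exists r, iter r (tact S) x = 0.
Proof.
move: x; apply: tspan_ind => [|a b x Ua Ub _ [r hr]].
  by exists 0%N.
have [r' _ hr'] := local_nilp SU Ua Ub.
exists (maxn r r'); rewrite (linear_mapD (iter_tact_linear (maxn r r'))).
rewrite (iter_tact_le (leq_maxl r r') hr).
by rewrite (iter_tact_le (leq_maxr r r') hr') addr0.
Qed.

Lemma tswap_span x : UU x -> UU (tswap x).
Proof.
move: x; apply: tspan_ind => [|a b x Ua Ub _ IH].
  by rewrite (linear_map0 (@tswap_linear _ _)); exact: tspan0.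
rewrite (linear_mapD (@tswap_linear _ _)).
apply: tspanD => //; rewrite /tswap (tlift_pure _ _ (@tswap_bilin _ _)).
have [_ _ Up] := local_subspace SU.
apply: tspan_sum => i; apply: tspan_pure; first exact: Up.
exact: (koszul_subspace _ (local_subspace SU)).
Qed.

Lemma mu12_regular x : UU x -> z2_regular (mu12 x vac).
Proof.
move: x; apply: tspan_ind => [|a b x Ua Ub _ IH] m1 m2 k1 k2 h.
  by rewrite mu12_0.
rewrite mu12D !fctE mu12_pure (IH _ _ _ _ h) addr0.
by rewrite (translation_covariant_vac T0 (UT Ub)) ?LF_0.
Qed.

Lemma exp_term_eq0 r k x : iter r (tact S) x = 0 -> (r <= k)%N ->
  iter k (@theta12_fin K V) (mu12 (iter k (tact S) x) vac) = 0.
Proof.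
by move=> hr rk; rewrite (iter_tact_le rk hr) mu12_0 iter_theta12_fin0.
Qed.

Lemma mu_exp12_fin r x m1 m2 k1 k2 : UU x -> iter r (tact S) x = 0 ->
  mu_exp12 S x vac m1 m2 k1 k2 = \sum_(k < r) k`!%:R^-1 *:
    iter k (@theta12_fin K V) (mu12 (iter k (tact S) x) vac) m1 m2 k1 k2.
Proof.
move=> Ux hr; pose g k : series2 V := k`!%:R^-1 *:
  iter k (@theta12_fin K V) (mu12 (iter k (tact S) x) vac).
rewrite /mu_exp12 (@fsbig_nat_trunc (series2 V) _ g r) ?series2_sumE // => k.
  rewrite /g iter_theta12_finE //.
  by apply: mu12_regular; exact: iter_tact_span.
by move=> rk; rewrite /g (exp_term_eq0 hr rk); exact: scaler0.
Qed.

Lemma mu_exp21_flip x : UU x -> mu_exp21 S x vac = flip (mu_exp12 S x vac).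
Proof.
move=> Ux; have [r hr] := tact_nilp Ux.
have E k : iter k (@theta21 K V) (mu21 (iter k (tact S) x) vac) =
    flip (iter k (@theta12_fin K V) (mu12 (iter k (tact S) x) vac)).
  rewrite -iter_theta12_finE; last first.
    by apply: mu12_regular; exact: iter_tact_span.
  (* The induction runs over the number of factors vartheta, with the power of S held at k. *)
  by elim: {1 3}k => [|j /= ->]; first exact: mu21_flip.
apply/funext => m1; apply/funext => m2; apply/funext => k1; apply/funext => k2.
rewrite /flip (mu_exp12_fin _ _ _ _ Ux hr) /mu_exp21.
pose g k : series2 V := k`!%:R^-1 *:
  flip (iter k (@theta12_fin K V) (mu12 (iter k (tact S) x) vac)).
rewrite (@fsbig_nat_trunc (series2 V) _ g r) ?series2_sumE // => k.
  by rewrite /g E.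
by move=> rk; rewrite /g (exp_term_eq0 hr rk); exact: scaler0.
Qed.

Lemma mu_exp12D x y : UU x -> UU y -> mu_exp12 S (x + y) vac =
  (mu_exp12 S x vac + mu_exp12 S y vac : series2 V).
Proof.
move=> Ux Uy; have [r hr] := tact_nilp Ux; have [r' hr'] := tact_nilp Uy.
have {}hr := iter_tact_le (leq_maxl r r') hr.
have {}hr' := iter_tact_le (leq_maxr r r') hr'.
have hl k : iter k (tact S) (x + y) = iter k (tact S) x + iter k (tact S) y.
  exact: (linear_mapD (iter_tact_linear k)).
apply/funext => m1; apply/funext => m2; apply/funext => k1; apply/funext => k2.
rewrite [RHS](_ : _ = mu_exp12 S x vac m1 m2 k1 k2 +
  mu_exp12 S y vac m1 m2 k1 k2) //.
rewrite (mu_exp12_fin _ _ _ _ Ux hr) (mu_exp12_fin _ _ _ _ Uy hr').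
rewrite (@mu_exp12_fin (maxn r r')); last 2 first.
- exact: tspanD.
- by rewrite hl hr hr' addr0.
rewrite -big_split; apply: eq_bigr => k _ /=.
by rewrite hl mu12D (linear_mapD (iter_theta12_fin_linear k)) -scalerDr.
Qed.

Lemma mu_exp12_0 : mu_exp12 S 0 vac = 0.
Proof.
apply/funext => m1; apply/funext => m2; apply/funext => k1; apply/funext => k2.
by rewrite (@mu_exp12_fin 0) ?big_ord0 //; exact: tspan0.
Qed.

Lemma mu_exp12_regular x : UU x -> z2_regular (mu_exp12 S x vac).
Proof.
move=> Ux m1 m2 k1 k2 h; have [r hr] := tact_nilp Ux.
rewrite (mu_exp12_fin _ _ _ _ Ux hr) big1 // => k _.
rewrite iter_theta12_fin_regular ?scaler0 //.
by apply: mu12_regular; exact: iter_tact_span.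
Qed.

(** * Consequences of locality on the vacuum *)

(** Further factors z_12 preserve locality, so the exponents of the pure summands can be added; the
    sign is carried by [tswap]. *)
Lemma local_span x : UU x -> exists N, iter N (@mulz12 K V) (mu_exp12 S x vac) =
  iter N (@mulz12 K V) (flip (mu_exp12 S (tswap x) vac)).
Proof.
have itD N (F G : series2 V) : iter N (@mulz12 K V) (F + G : series2 V) =
    (iter N (@mulz12 K V) F + iter N (@mulz12 K V) G : series2 V).
  exact: (linear_mapD (iter_mulz12_linear N)).
move: x; apply: tspan_ind => [|a b x Ua Ub Ux [N hN]].
  by exists 0%N; rewrite (linear_map0 (@tswap_linear _ _)) mu_exp12_0.
have Uab := tspan_pure Ua Ub.
have [M /(_ vac) hM] := local_comm SU Ua Ub.
exists (M + N)%N; rewrite (linear_mapD (@tswap_linear _ _)).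
rewrite !mu_exp12D //; try exact: tswap_span.
rewrite [flip _](_ : _ = (flip (mu_exp12 S (tswap (tpure a b)) vac) +
  flip (mu_exp12 S (tswap x) vac) : series2 V)) // !itD.
rewrite -mu_exp21_flip; last exact: tswap_span.
by congr (_ + _); [rewrite addnC|]; rewrite !iterD ?hM ?hN.
Qed.

(* The fields applied to the vacuum contain no logarithms, so the left hand
   side of locality does not contain zeta_2 and the right hand side does not
   contain zeta_1. *)
Lemma mu_exp12_nolog x m1 m2 k1 k2 : UU x -> (0 < k1)%N ->
  mu_exp12 S x vac m1 m2 k1 k2 = 0.
Proof.
move=> Ux k1_gt0; have [N hN] := local_span Ux.
apply: (@iter_mulz12_inj _ _ N (mu_exp12 S x vac)) => [n1 n2 hn|n1 n2].
  by apply: mu_exp12_regular => //; left.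
rewrite hN; apply: iter_mulz12_slice => {}n1 {}n2; rewrite /flip.
by apply: mu_exp12_regular; [exact: tswap_span | right].
Qed.

(** Locality gives z_12^N E(x) = 0, and z_12 has no kernel on series without negative powers of
    z_2. *)
Lemma local_vanish x : UU x -> mu_exp12 S (tswap x) vac = 0 ->
  mu_exp12 S x vac = 0.
Proof.
move=> Ux h0; have [N] := local_span Ux; rewrite h0 => hN.
apply/funext => m1; apply/funext => m2; apply/funext => k1; apply/funext => k2.
apply: (@iter_mulz12_inj _ _ N (mu_exp12 S x vac)) => [n1 n2 hn|n1 n2].
  by apply: mu_exp12_regular => //; left.
by rewrite hN; apply: iter_mulz12_slice.
Qed.

(** * Translation covariance of E(x) and its value at z_2 = 0 *)

Definition applyT (F : series2 V) : series2 V :=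
  fun m1 m2 k1 k2 => T (F m1 m2 k1 k2).

Lemma applyT_linear c (F G : series2 V) :
  applyT (c *: F + G : series2 V) = (c *: applyT F + applyT G : series2 V).
Proof.
apply/funext => m1; apply/funext => m2; apply/funext => k1; apply/funext => k2.
exact: linearP.
Qed.

Lemma applyT_theta12 F : applyT (theta12_fin F) = theta12_fin (applyT F).
Proof.
apply/funext => m1; apply/funext => m2; apply/funext => k1; apply/funext => k2.
rewrite /applyT /theta12_fin linearB linear_sum /=; congr (_ - _).
  by case: k1 => //; rewrite linear0.
by apply: eq_bigr => i _; rewrite linearZ.
Qed.

(** T a b 1 = [T, a] b 1 + a [T, b] 1 + a b T 1, and T 1 = 0. *)
Lemma mu12_covariant x : UU x -> applyT (mu12 x vac) = Dz12 (mu12 x vac).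
Proof.
move: x; apply: tspan_ind => [|a b x Ua Ub _ IH].
  rewrite mu12_0 (linear_map0 applyT_linear).
  by rewrite (linear_map0 (@Dz12_linear _ _)).
rewrite mu12D (linear_mapD applyT_linear) (linear_mapD (@Dz12_linear _ _)) IH.
congr (_ + _).
apply/funext => m1; apply/funext => m2; apply/funext => k1; apply/funext => k2.
rewrite /applyT /Dz12 !mu12_pure.
have hTa v n k := congr1 (fun b : LF V => b v n k) (UT Ua).
have hTb v n k := congr1 (fun b : LF V => b v n k) (UT Ub).
have := hTa (b vac m2 k2) m1 k1; rewrite /= /adT_fun /Dz_fun.
move/eqP; rewrite subr_eq => /eqP ->; congr (_ + _).
have := hTb vac m2 k2; rewrite /= /adT_fun /Dz_fun T0 LF_0 subr0 => ->.
rewrite LF_linear; congr (_ + _).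
have := LF_linear a m1 k1 k2.+1%:R (b vac (m2 + 1) k2.+1) 0.
by rewrite !addr0 LF_0 addr0.
Qed.

(** T and D_(z1) + D_(z2) both commute with multiplication by vartheta_12. *)
Lemma iter_theta12_covariant k x : UU x ->
  applyT (iter k (@theta12_fin K V) (mu12 x vac)) =
  Dz12 (iter k (@theta12_fin K V) (mu12 x vac)).
Proof.
move=> Ux; elim: k => [|k IH] /=; first exact: mu12_covariant.
rewrite applyT_theta12 IH Dz12_theta12 //.
by apply: iter_theta12_fin_regular; exact: mu12_regular.
Qed.

Lemma mu_exp12_covariant x : UU x ->
  applyT (mu_exp12 S x vac) = Dz12 (mu_exp12 S x vac).
Proof.
move=> Ux; have [r hr] := tact_nilp Ux.
apply/funext => m1; apply/funext => m2; apply/funext => k1; apply/funext => k2.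
rewrite /applyT /Dz12 !(mu_exp12_fin _ _ _ _ Ux hr) linear_sum !scaler_sumr.
rewrite -!big_split; apply: eq_bigr => k _ /=.
have := iter_theta12_covariant k (iter_tact_span k Ux).
move/(congr1 (fun F : series2 V => k`!%:R^-1 *: F m1 m2 k1 k2)).
rewrite /applyT /Dz12 /= linearZ /= => ->.
by rewrite !scalerDr !scalerA !(mulrC k`!%:R^-1).
Qed.

(* T = D_(z1) + D_(z2) on mu_exp12 x is a recursion on the exponent of z2. *)
Lemma mu_exp12_eq0 x : UU x -> (forall m, mu_exp12 S x vac m 0 0 0 = 0) ->
  mu_exp12 S x vac = 0.
Proof.
move=> Ux h; have reg := mu_exp12_regular Ux.
apply/funext => m1; apply/funext => m2; apply/funext => k1; apply/funext => k2.
case: k2 => [|k2]; last by apply: reg; right.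
case: k1 => [|k1]; last exact: mu_exp12_nolog.
case: m2 => m2; last by apply: reg; left.
elim: m2 m1 => [|n IH] m1; first exact: h.
have := congr1 (fun F : series2 V => F m1 n%:Z 0 0)
  (mu_exp12_covariant Ux).
rewrite /= /applyT /Dz12 !IH linear0 (mu_exp12_nolog _ _ _ Ux) //.
rewrite (reg _ _ _ 1%N); last by right.
rewrite !scaler0 addr0 add0r addr0 (_ : n%:Z + 1 = n.+1); last by lia.
by move/esym/eqP; rewrite scaler_eq0 intr_eq0 => /eqP.
Qed.

(* the coefficients of a(z) b_0, for x = a (x) b and b_0 = b(z)1 at z = 0 *)
Definition act_at_zero x m k : V := mu12 x vac m 0 k 0.

(** At z_2 = 0 vartheta_12 becomes zeta_1, hence E(x) becomes e^(zeta_1 S) m(x). *)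
Lemma mu_exp12_z20 x m k : UU x -> mu_exp12 S x vac m 0 k 0 =
  \sum_(i < k.+1) i`!%:R^-1 *: act_at_zero (iter i (tact S) x) m (k - i).
Proof.
move=> Ux; have [r hr] := tact_nilp Ux.
(* The cutoff is raised to at least k + 1, so that it covers all i <= k. *)
have {}hr := iter_tact_le (leq_maxl r k.+1) hr.
rewrite (mu_exp12_fin _ _ _ _ Ux hr).
rewrite (big_ord_widen _ (fun i => i`!%:R^-1 *:
  act_at_zero (iter i (tact S) x) m (k - i)%N)
  (leq_maxr r k.+1)).
rewrite [RHS]big_mkcond; apply: eq_bigr => i _.
rewrite iter_theta12_fin_z20 ltnS.
by case: ifP => // _; rewrite scaler0.
Qed.

(** E(S^j x) has no logarithms, so the positive powers of zeta in e^(zeta S) m(S^j x) vanish, and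
    [convolution_deriv] applies. *)
Lemma act_at_zero_deriv x m j k : UU x ->
  k.+1%:R *: act_at_zero (iter j (tact S) x) m k.+1 +
  act_at_zero (iter j.+1 (tact S) x) m k = 0.
Proof.
move=> Ux; move: j k.
apply: (convolution_deriv
  (M := fun j k => act_at_zero (iter j (tact S) x) m k)) => j k.
have := mu_exp12_z20 m k.+1 (iter_tact_span j Ux).
rewrite mu_exp12_nolog //; last exact: iter_tact_span.
by move=> /esym; under eq_bigr => i _ do rewrite -iterD addnC.
Qed.

Lemma act_at_zero_iter x m : UU x -> (forall k, act_at_zero x m k = 0) ->
  forall j k, act_at_zero (iter j (tact S) x) m k = 0.
Proof.
move=> Ux h; elim=> [|j IH] k //.
by have := act_at_zero_deriv m j k Ux; rewrite IH scaler0 add0r.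
Qed.

(** * Transport of vanishing along the flip P *)

Hypothesis swapS : forall x, tact S (tswap x) = tswap (tact S x).

(** Vanishing passes from m to E on the side of P x, where the value at z_2 = 0 determines E,
    crosses to x by locality, and returns from E to m. *)
Lemma act_at_zero_swap x : UU x ->
  (forall m k, act_at_zero (tswap x) m k = 0) ->
  forall m k, act_at_zero x m k = 0.
Proof.
move=> Ux h m k; have Ux' := tswap_span Ux.
have iswap j : iter j (tact S) (tswap x) = tswap (iter j (tact S) x).
  by elim: j => //= j ->; exact: swapS.
have h0 j : mu_exp12 S (iter j (tact S) x) vac = 0.
  apply: local_vanish; first exact: iter_tact_span.
  rewrite -iswap; apply: mu_exp12_eq0 => [|n]; first exact: iter_tact_span.
  rewrite mu_exp12_z20; last exact: iter_tact_span.
  by rewrite big_ord1 /= (act_at_zero_iter Ux' (h n)) scaler0.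
(* Each e^(zeta S) m(S^j x) is now 0; inverting the exponential needs all j together. *)
apply: (convolution_eq0
  (A := fun j k => act_at_zero (iter j (tact S) x) m k) _ 0) => j l.
have := mu_exp12_z20 m l (iter_tact_span j Ux).
by rewrite h0 => /esym; under eq_bigr => i _ do rewrite -iterD addnC.
Qed.

Hypothesis vac_even : homogeneous false vac.

(** c(z) b_0 is m(c (x) b), whereas m(P(c (x) b)) applies parity parts of b(z) to the constant terms
    of Koszul-signed copies of c(z) 1, all of them 0. *)
Lemma local_uniqueness (c : LF V) : U c -> at_zero (c vac) = 0 ->
  forall b, U b -> forall n k, c (at_zero (b vac)) n k = 0.
Proof.
move=> Uc c0 b Ub n k.
(* The vacuum being even, the parity p part of c(z) sends it to the parity p part of c(z) 1. *)
have part0 p : at_zero (parity_part p c vac) = 0.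
  rewrite /at_zero /= /lf_part_fun big_bool /=.
  have -> : parity_part true vac = 0.
    by rewrite -vac_even parity_partK.
  rewrite LF_0 linear0 add0r vac_even.
  by move: c0; rewrite /at_zero => ->; rewrite linear0.
have kos0 p : koszul p c vac 0 0 = 0.
  rewrite /koszul LF_addscaleE.
  have := (part0 false, part0 true); rewrite /at_zero => -[-> ->].
  by rewrite scaler0 addr0.
have := @act_at_zero_swap (tpure c b) (tspan_pure Uc Ub) _ n k.
rewrite /act_at_zero mu12_pure; apply=> m l.
rewrite /tswap (tlift_pure _ _ (@tswap_bilin _ _)) big_bool /=.
rewrite mu12D !fctE !mu12_pure.
by rewrite !kos0 !LF_0 addr0.
Qed.

End Local.

(** * Comparison of a field with the field of its value on the vacuum *)

Theorem theorem3p4 (R : realType) (V : superType R[i]) (vac : V)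
  (T : {linear V -> V}) (Y : {linear V -> LF V}) (S : braiding_map (LF V))
  (HV : is_log_vertex_algebra vac T Y S)
  (U : set (LF V)) (HT : U `<=` LF_T T) (HS : is_local S U)
  (HY : range Y `<=` U) :
  U = range Y /\ forall a : LF V, U a -> a = Y (at_zero (a vac)).
Proof.
have main (a : LF V) : U a -> a = Y (at_zero (a vac)).
  move=> Ua; set v := at_zero _.
  have [UD UZ] := subspace_addscale (local_subspace HS).
  have Uc : U (a - Y v).
    by apply: UD => //; rewrite -scaleN1r; apply: UZ; apply: HY; exists v.
  have c0 : at_zero ((a - Y v : LF V) vac) = 0.
    have := lva_Y_at_zero HV v; rewrite /at_zero /= => hv.
    by rewrite !fctE hv subrr.
  apply/eqP; rewrite -subr_eq0; apply/eqP; apply: LF_ext => b n k.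
  (* Every vector of V is the value at z = 0 of some Y(b, z) 1, so vanishing on such values is
     vanishing on V. *)
  rewrite -(lva_Y_at_zero HV b).
  apply: (local_uniqueness (lva_T_vac HV) HT HS (braid_swap (braidP S))
    (lva_vac_even HV) Uc c0).
  by apply: HY; exists b.
split=> //; apply/seteqP; split=> // a Ua; exists (at_zero (a vac)) => //.
exact/esym/main.
Qed.
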